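(* Let $A\in\mathbb{Z}^{m\times n}$ with $\operatorname{rank}(A)=n$, and let $\mathcal{G}\subseteq\mathbb{Z}^m$ be the set of all $b\in\mathbb{Z}^m$ such that either $P(A,b)=\emptyset$, or $$A_jA_I^{-1}b_I+(n\Delta^{\max})^2\le b_j\quad\text{for all feasible bases } I \text{ for } P(A,b) \text{ and all } j\in\{1,\dots,m\}\setminus I.$$ Then $\Pr(\mathcal{G})=1$. Moreover, if $b\in\mathcal{G}$, then either $P(A,b)=\emptyset$, or a point of $P(A,b)\cap\mathbb{Z}^n$ can be identified by finding a feasible basis $I$ for $P(A,b)$, computing a mixed integer hull $W\text{-}\mathrm{MIP}(A_I,b_I)$ equal to $\mathrm{IP}(A_I,b_I)$, and finding a vertex of $W\text{-}\mathrm{MIP}(A_I,b_I)$. That is, if $b\in\mathcal{G}$ and $P(A,b)\neq\emptyset$, then a feasible basis exists, and for every feasible basis $I$ and every integer matrix $W$ with $n$ columns satisfying $W\text{-}\mathrm{MIP}(A_I,b_I)=\mathrm{IP}(A_I,b_I)$ (such $W$ exists), the set $W\text{-}\mathrm{MIP}(A_I,b_I)$ has a vertex and each of its vertices lies in $P(A,b)\cap\mathbb{Z}^n$.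
   Context: For an integer matrix $M$ with $n$ columns and an integer vector $d$, $P(M,d):=\{x\in\mathbb{R}^n: Mx\le d\}$ and $\mathrm{IP}(M,d):=\operatorname{conv}\{x\in P(M,d): x\in\mathbb{Z}^n\}$; for $W\in\mathbb{Z}^{k\times n}$, $W\text{-}\mathrm{MIP}(M,d):=\operatorname{conv}\{x\in P(M,d): Wx\in\mathbb{Z}^k\}$. $A_j$ denotes the $j$-th row of $A$; for $I\subseteq\{1,\dots,m\}$, $A_I$ and $b_I$ denote the rows of $A$, respectively the entries of $b$, indexed by $I$. A set $I\subseteq\{1,\dots,m\}$ is a basis if $|I|=n$ and $\operatorname{rank}(A_I)=n$; a basis $I$ is feasible for $P(A,b)$ if $A_I^{-1}b_I\in P(A,b)$. $\Delta^{\max}:=\Delta^{\max}(A)$ is the maximum of $|\det(B)|$ over all square submatrices $B$ of $A$ of any size. The density of a set $\mathcal{A}\subseteq\mathbb{Z}^m$ is $$\Pr(\mathcal{A}):=\liminf_{t\to\infty}\frac{|\{-t,\dots,t\}^m\cap\mathcal{A}|}{|\{-t,\dots,t\}^m|}.$$ *)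

(* Defs.v *)
(* MathComp / MathComp-Analysis *)
From mathcomp Require Import all_boot all_order all_algebra finmap.
From mathcomp Require Import all_classical all_reals all_analysis.
Set Implicit Arguments.
Unset Strict Implicit.
Unset Printing Implicit Defensive.
Import Order.TTheory GRing.Theory Num.Theory.
Local Open Scope classical_set_scope.
Local Open Scope ring_scope.

Definition intmx (R : realType) (p q : nat) (M : 'M[int]_(p, q)) : 'M[R]_(p, q) :=
  map_mx intr M.
Arguments intmx R {p q} M.

Definition polyhedron (R : realType) (p n : nat) (M : 'M[int]_(p, n))
    (d : 'cV[int]_p) : set 'cV[R]_n :=
  [set x | forall i, (intmx R M *m x) i 0 <= intmx R d i 0].
Arguments polyhedron R {p n} M d.

Definition convex_hull (R : realType) (n : nat) (S : set 'cV[R]_n) : set 'cV[R]_n :=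
  smallest (@convex_set R 'cV[R]_n) S.

Definition IP (R : realType) (p n : nat) (M : 'M[int]_(p, n))
    (d : 'cV[int]_p) : set 'cV[R]_n :=
  convex_hull [set x | polyhedron R M d x /\ x \is a mxOver Num.int].
Arguments IP R {p n} M d.

Definition MIP (R : realType) (k p n : nat) (W : 'M[int]_(k, n))
    (M : 'M[int]_(p, n)) (d : 'cV[int]_p) : set 'cV[R]_n :=
  convex_hull [set x | polyhedron R M d x /\ intmx R W *m x \is a mxOver Num.int].
Arguments MIP R {k p n} W M d.

(* Vertices as extreme points; for (rational) polyhedra these are the
   0-dimensional faces. *)
Definition is_vertex (R : realType) (n : nat) (S : set 'cV[R]_n) (v : 'cV[R]_n) :=
  S v /\ forall (x y : 'cV[R]_n) (t : R), S x -> S y -> 0 < t -> t < 1 ->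
    v = t *: x + (1 - t) *: y -> x = v /\ y = v.

(* The rows of M indexed by I, listed in increasing order. *)
Definition subrows (T : Type) (m p : nat) (M : 'M[T]_(m, p)) (I : {set 'I_m}) :
    'M[T]_(#|I|, p) :=
  rowsub (fun k : 'I_#|I| => enum_val k) M.

Definition is_basis (R : realType) (m n : nat) (A : 'M[int]_(m, n))
    (I : {set 'I_m}) : Prop :=
  #|I| = n /\ \rank (intmx R (subrows A I)) = n.
Arguments is_basis R {m n} A I.

(* A_I^-1 b_I.  When I is a basis, A_I is square only up to the propositional
   equality #|I| = n, so the inverse is taken with pinvmx, which needs no cast;
   by the two lemmas below it is then the two-sided inverse of A_I. *)
Definition basic_sol (R : realType) (m n : nat) (A : 'M[int]_(m, n))
    (b : 'cV[int]_m) (I : {set 'I_m}) : 'cV[R]_n :=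
  pinvmx (intmx R (subrows A I)) *m intmx R (subrows b I).
Arguments basic_sol R {m n} A b I.

Lemma basis_mulmxV (R : realType) (m n : nat) (A : 'M[int]_(m, n))
    (I : {set 'I_m}) : is_basis R A I ->
  intmx R (subrows A I) *m pinvmx (intmx R (subrows A I)) = 1%:M.
Proof. by case=> cI rI; apply: mulmxVp; rewrite /row_free rI cI. Qed.

Lemma basis_mulVmx (R : realType) (m n : nat) (A : 'M[int]_(m, n))
    (I : {set 'I_m}) : is_basis R A I ->
  pinvmx (intmx R (subrows A I)) *m intmx R (subrows A I) = 1%:M.
Proof. by case=> cI rI; apply: mulVpmx; rewrite /row_full rI. Qed.

Definition feasible_basis (R : realType) (m n : nat) (A : 'M[int]_(m, n))
    (b : 'cV[int]_m) (I : {set 'I_m}) : Prop :=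
  is_basis R A I /\ polyhedron R A b (basic_sol R A b I).
Arguments feasible_basis R {m n} A b I.

Definition increasing (k p : nat) (f : {ffun 'I_k -> 'I_p}) : bool :=
  [forall i : 'I_k, forall j : 'I_k, (i < j)%N ==> (f i < f j)%N].

(* The (k+1) x (k+1) submatrices are given by increasing selections f of rows
   and g of columns. *)
Definition Delta_max (m n : nat) (A : 'M[int]_(m, n)) : nat :=
  (\max_(k < minn m n)
     \max_(f : {ffun 'I_k.+1 -> 'I_m} | increasing f)
       \max_(g : {ffun 'I_k.+1 -> 'I_n} | increasing g)
          `|\det (mxsub f g A)|)%N.

(* {-t, ..., t}^m *)
Definition box (m t : nat) : set 'cV[int]_m :=
  [set b | forall i, - t%:Z <= b i 0 <= t%:Z].
Arguments box m t : clear implicits.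

(* fset_set is meaningful on finite sets only. *)
Lemma finite_box (m t : nat) : finite_set (box m t).
Proof.
pose h (f : {ffun 'I_m -> 'I_(t + t).+1}) : 'cV[int]_m :=
  \col_i ((f i : nat)%:Z - t%:Z).
apply: (@sub_finite_set _ _ (h @` setT)); last exact/finite_image/finite_finset.
move=> b bt; exists [ffun i => inord (absz (b i 0 + t%:Z))] => //.
apply/matrixP => i j; rewrite !mxE ffunE (ord1 j).
have /andP[lb ub] := bt i.
have ge0 : 0 <= b i 0 + t%:Z by rewrite -lerBlDr sub0r.
rewrite inordK; first by rewrite gez0_abs// addrK.
by rewrite ltnS -lez_nat gez0_abs// PoszD lerD2r.
Qed.

(* The ratio lies in [0, 1], so the real-valued limn_inf is a genuine liminf. *)
Definition density (R : realType) (m : nat) (S : set 'cV[int]_m) : R :=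
  limn_inf (fun t : nat =>
    #|` fset_set (box m t `&` S)|%:R / #|` fset_set (box m t)|%:R).
Arguments density R {m} S.

Definition good_rhs (R : realType) (m n : nat) (A : 'M[int]_(m, n)) :
    set 'cV[int]_m :=
  [set b | polyhedron R A b = set0 \/
    forall I : {set 'I_m}, feasible_basis R A b I ->
      forall j : 'I_m, j \notin I ->
        (row j (intmx R A) *m basic_sol R A b I) 0 0
          + (n%:R * (Delta_max A)%:R) ^+ 2 <= intmx R b j 0].
Arguments good_rhs R {m n} A.

(* Main.v *)
Require Import Defs.
From mathcomp Require Import all_boot all_order all_algebra.
From mathcomp Require Import all_classical all_reals all_analysis.
From mathcomp Require Import perm finmap ring lra zify.
Import Order.TTheory GRing.Theory Num.Theory.
Import numFieldNormedType.Exports.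
Set Implicit Arguments.
Unset Strict Implicit.
Unset Printing Implicit Defensive.
Local Open Scope classical_set_scope.
Local Open Scope ring_scope.

(** The statement on vertices is a proximity estimate.  Fix a basis [I] and write [B] for [A_I]
    and [x] for the basic solution [B^-1 b_I].

    A vertex [v] of the convex hull of the integer points of the cone
    [B y <= b_I] is an integer point, and every entry of its slack
    [s = b_I - B v] is smaller than [|\det B|]: the integer vector
    [u = adj(B) e_i] satisfies [B u = \det B e_i], so a slack [s_i] of at least
    [|\det B|] would leave room for both [v + u] and [v - u] in the cone, with
    [v] as their midpoint ([vertex_slack_lt]).  For a further row [A_j],
    [\det B * A_j (x - v) = (A_j adj(B)) s], and by Cramer's rule the entries of
    [A_j adj(B)] are, up to sign, [n * n] minors of [A], or zero.  Hence
    [A_j v <= A_j x + n Delta] ([vertex_row_le]).  As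
    [n Delta <= (n Delta)^2], the inequalities that define a good right-hand
    side give [A_j v <= b_j], so [v] lies in the whole polyhedron.

    Such a vertex exists ([IP_vertex_exists]): among the integer points of the
    cone, take one with the least sum of slacks and, among these finitely many,
    with the largest sum of squared slacks; the first criterion is linear and
    the second is strictly convex.  A feasible basis exists because a point of
    the polyhedron whose tight rows have rank below [n] can be moved along the
    kernel of these rows until another row becomes tight
    ([tight_rank_increase]).  The hull of the integer points is itself a mixed
    integer hull, with [W] the identity.

    For the density, a right-hand side [b] is bad only if some feasible [I] and
    [j \notin I] have [c <= b_j < c + (n Delta)^2], where
    [c = A_j A_I^-1 b_I] does not involve [b_j].  So, for each of the
    finitely many pairs [(I, j)], at most [(n Delta)^2] of the [2t + 1] values
    of [b_j] in the box are bad once the other coordinates are fixed, and the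
    proportion of bad points is [O(1/t)] ([card_strip], [density_eq1]). *)

(** * Extreme points of convex hulls *)

Section ConvexHull.
Variables (R : realType) (n : nat).
Implicit Types (S C : set 'cV[R]_n) (v : 'cV[R]_n).

(** Removing an extreme point from a convex set leaves a convex set, so if [v]
    were not in [S] the hull of [S] would not be minimal. *)
Lemma vertex_hull_mem S v : is_vertex (convex_hull S) v -> S v.
Proof.
move=> [Sv ext]; apply: contrapT => NSv.
suff : (convex_hull S `\ v) v by case=> _; exact.
apply: (Sv (convex_hull S `\ v)); split; last first.
  move=> x Sx; split; first by move=> C [_]; exact.
  by move=> /= xv; apply: NSv; rewrite -xv.
apply/convex_setW => x y /set_mem[Sx xv] /set_mem[Sy yv] k k0 k1.
apply/mem_set; split.
  move=> C [cC SC]; apply/set_mem/cC; apply/mem_set; [exact: Sx|exact: Sy].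
by move=> /= /esym vE; have [/xv] := ext x y k%:num Sx Sy k0 k1 vE.
Qed.

(** The hull itself is hard to describe, so extremality of [v] is checked in a
    larger explicit convex set. *)
Lemma is_vertex_hull S C v : convex_set C -> S `<=` C -> S v ->
  is_vertex C v -> is_vertex (convex_hull S) v.
Proof.
move=> cC SC Sv [_ ext]; split; first by move=> D [_]; exact.
by move=> x y t Sx Sy; apply: ext; [exact: Sx | exact: Sy].
Qed.

End ConvexHull.

(** * Minors and the adjugate *)

Section Adjugate.
Variables (n : nat) (B : 'M[int]_n).

(** Cramer's rule: both sides have the same expansion along row [i]. *)
Lemma mul_row_adj (a : 'rV[int]_n) i :
  (a *m \adj B) 0 i =
  \det (\matrix_(k, l) if k == i then a 0 l else B k l).
Proof.
rewrite (expand_det_row _ i) mxE; apply: eq_bigr => l _.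
rewrite !mxE eqxx; congr (_ * _); rewrite /cofactor; congr (_ * \det _).
by apply/matrixP => k k'; rewrite !mxE eq_sym (negPf (neq_lift _ _)).
Qed.

End Adjugate.

Lemma absz_det_row_perm n (s : 'S_n) (M : 'M[int]_n) :
  `|\det (row_perm s M)|%N = `|\det M|%N.
Proof. by rewrite row_permE det_mulmx det_perm abszM abszX exp1n mul1n. Qed.

Lemma ltn_enum_val m (F : {set 'I_m}) (i j : 'I_#|F|) :
  (i < j)%N -> (enum_val i < enum_val j)%N.
Proof.
have srt : sorted ltn (map val (enum F)).
  rewrite -[enum _](eq_filter (mem_enum _)) -(eq_filter (mem_map val_inj _)).
  rewrite -filter_map (sorted_filter ltn_trans)// unlock val_ord_enum.
  exact: iota_ltn_sorted.
move=> ij; have iF : (i < size (enum F))%N by rewrite -cardE.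
have jF : (j < size (enum F))%N by rewrite -cardE.
have := @sorted_ltn_nth _ ltn ltn_trans 0%N _ srt i j.
rewrite !inE !size_map => /(_ iF jF ij).
by rewrite !(nth_map (enum_default i)) ?size_map// -!enum_val_nth.
Qed.

(** [Delta_max] only ranges over increasing selections of rows and columns.  A
    selection with a repetition has determinant [0], and an injective one is a
    permutation of the increasing enumeration of its image. *)
Lemma absz_det_rowsub m k (A : 'M[int]_(m, k.+1)) (f : 'I_k.+1 -> 'I_m) :
  (`|\det (rowsub f A)| <= Delta_max A)%N.
Proof.
have [/injectiveP f_inj|] := boolP (injectiveb f); last first.
  case/injectivePn => i [j ij fij].
  by rewrite (@determinant_alternate _ _ _ i j)// => l; rewrite !mxE fij.
have cF : #|[set f x | x in 'I_k.+1]%SET| = k.+1 by rewrite card_imset ?card_ord.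
have km : (k < minn m k.+1)%N.
  by rewrite leq_min ltnSn andbT -cF -[X in (_ <= X)%N]card_ord max_card.
pose F := [set f x | x in 'I_k.+1]%SET.
pose g : {ffun 'I_k.+1 -> 'I_m} := [ffun i => enum_val (cast_ord (esym cF) i)].
have fF i : f i \in F by exact: imset_f.
pose s0 i := cast_ord cF (enum_rank_in (fF ord0) (f i)).
have gs i : g (s0 i) = f i by rewrite ffunE cast_ordK enum_rankK_in.
have s_inj : injective s0 by move=> i j /(congr1 g); rewrite !gs => /f_inj.
have -> : rowsub f A = row_perm (perm s_inj) (rowsub g A).
  by apply/matrixP => i j; rewrite !mxE permE gs.
rewrite absz_det_row_perm.
have gE : increasing g.
  apply/forallP => i; apply/forallP => j; apply/implyP => ij; rewrite !ffunE.
  exact: ltn_enum_val.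
pose h : {ffun 'I_k.+1 -> 'I_k.+1} := [ffun i => i].
have hE : increasing h.
  by apply/forallP => i; apply/forallP => j; apply/implyP; rewrite !ffunE.
have -> : rowsub g A = mxsub g h A by apply/matrixP => i j; rewrite !mxE [h _]ffunE.
rewrite /Delta_max.
apply: leq_trans (leq_bigmax (Ordinal km)) => /=.
apply: leq_trans (leq_bigmax_cond g gE) => /=.
exact: (leq_bigmax_cond h hE).
Qed.

(** * Integer matrices over the reals *)

Section IntegerMatrices.
Variable R : realType.

Lemma intmxM p q r (M : 'M[int]_(p, q)) (N : 'M[int]_(q, r)) :
  intmx R (M *m N) = intmx R M *m intmx R N.
Proof. exact: map_mxM. Qed.

Lemma mxOver_int_intmx p q (x : 'M[R]_(p, q)) :
  x \is a mxOver Num.int <-> exists z, x = intmx R z.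
Proof.
split=> [/mxOverP xint|[z ->]]; last first.
  by apply/mxOverP => i j; rewrite mxE intr_int.
exists (map_mx Num.floor x); apply/matrixP => i j; rewrite !mxE.
by rewrite floorK// xint.
Qed.

Lemma polyhedron_intmx p n (M : 'M[int]_(p, n)) (d : 'cV[int]_p) z :
  polyhedron R M d (intmx R z) <-> forall i, (M *m z) i 0 <= d i 0.
Proof.
by split=> Pz i; have := Pz i; rewrite -intmxM !mxE ler_int.
Qed.

Variables (n : nat) (B : 'M[int]_n).

Lemma rank_intmx_det : \rank (intmx R B) = n -> \det B != 0.
Proof.
move=> rB; have : intmx R B \in unitmx by rewrite -row_full_unit /row_full rB.
by rewrite unitmxE det_map_mx unitfE intr_eq0.
Qed.

Lemma mul_intmx_inj : \det B != 0 -> injective (fun x : 'cV[R]_n => intmx R B *m x).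
Proof.
move=> dB; have uB : intmx R B \in unitmx.
  by rewrite unitmxE det_map_mx unitfE intr_eq0.
by move=> x y /(congr1 (mulmx (invmx (intmx R B)))); rewrite !mulKmx.
Qed.

End IntegerMatrices.

(** * Integer points of a simplicial cone *)

Section SimplicialCone.
Variables (R : realType) (n : nat) (B : 'M[int]_n) (d : 'cV[int]_n).
Hypothesis detB : \det B != 0.

(** In the coordinates [B z] the cone is an orthant, and by the adjugate
    identity every multiple of [\det B] is reached by an integer point; the
    vector [- (\det B)^2 |d|] is such a multiple below [d]. *)
Lemma exists_int_point : exists z : 'cV[int]_n, forall i, (B *m z) i 0 <= d i 0.
Proof.
exists (\adj B *m (- \det B *: \col_i `|d i 0|)) => i.
rewrite mulmxA mul_mx_adj mul_scalar_mx !mxE.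
have D1 : 1 <= \det B * \det B by nia.
apply: (le_trans _ (lerNnormlW (lexx `|d i 0|))).
by rewrite mulNr mulrN lerN2 mulrA ler_peMl.
Qed.

Definition slack (z : 'cV[int]_n) := d - B *m z.
Definition rslack (x : 'cV[R]_n) := intmx R d - intmx R B *m x.

Lemma rslack_intmx z i : rslack (intmx R z) i 0 = (slack z i 0)%:~R.
Proof. by rewrite /rslack -intmxM !mxE rmorphB. Qed.

Lemma rslack_conv (t : R) x y :
  rslack (t *: x + (1 - t) *: y) = t *: rslack x + (1 - t) *: rslack y.
Proof.
rewrite /rslack mulmxDr -!scalemxAr !scalerBr addrACA -opprD -scalerDl.
by rewrite [t + _]addrC subrK scale1r.
Qed.

Definition slack_sum x := \sum_i rslack x i 0.
Definition slack_sqr x := \sum_i rslack x i 0 ^+ 2.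

Lemma slack_sum_conv t x y :
  slack_sum (t *: x + (1 - t) *: y) = t * slack_sum x + (1 - t) * slack_sum y.
Proof.
rewrite /slack_sum rslack_conv !mulr_sumr -big_split/=.
by apply: eq_bigr => i _; rewrite !mxE.
Qed.

(** The last term, [t (1 - t)] times the squared distance of the two slack
    vectors, quantifies the strict convexity of the sum of squares; it is what
    makes a maximizer extreme. *)
Lemma slack_sqr_conv t x y :
  slack_sqr (t *: x + (1 - t) *: y) = t * slack_sqr x + (1 - t) * slack_sqr y
    - t * (1 - t) * \sum_i (rslack x i 0 - rslack y i 0) ^+ 2.
Proof.
rewrite /slack_sqr rslack_conv !mulr_sumr -big_split/= -sumrB.
by apply: eq_bigr => i _; rewrite !mxE; ring.
Qed.

Lemma rslack_inj x y :
  \sum_i (rslack x i 0 - rslack y i 0) ^+ 2 <= 0 -> x = y.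
Proof.
move=> s0; apply: (mul_intmx_inj detB) => /=.
have {}s0 : \sum_i (rslack x i 0 - rslack y i 0) ^+ 2 = 0.
  by apply/le_anti; rewrite s0 sumr_ge0// => i _; exact: sqr_ge0.
apply/colP => i; have /eqP := psumr_eq0P (fun i _ => sqr_ge0 _) s0 (i := i) isT.
rewrite sqrf_eq0 subr_eq0 => /eqP; rewrite /rslack.
by rewrite !mxE => /addrI /oppr_inj.
Qed.

(** Points that are lexicographically no better than [(l, q)], when the linear
    [slack_sum] is to be minimized first and the strictly convex [slack_sqr] is
    then to be maximized.  The set is convex because sublevel sets of a convex
    function are, and a point attaining [(l, q)] is extreme in it by strict
    convexity. *)
Definition lex_set (l q : R) :=
  [set x | l < slack_sum x \/ slack_sum x = l /\ slack_sqr x <= q].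

Lemma lex_set_convex l q : convex_set (lex_set l q).
Proof.
apply/convex_setW => x y /set_mem Cx /set_mem Cy k k0 k1; apply/mem_set.
have -> : conv k x y = k%:num *: (x : 'cV[R]_n) + (1 - k%:num) *: (y : 'cV[R]_n) by [].
rewrite /lex_set/= slack_sum_conv slack_sqr_conv.
set D := \sum_i _; have D0 : 0 <= D by apply: sumr_ge0 => i _; exact: sqr_ge0.
have kD : 0 <= k%:num * (1 - k%:num) * D by rewrite !mulr_ge0// subr_ge0 ltW.
move: Cx Cy; rewrite /lex_set/=.
move: (slack_sum x) (slack_sum y) (slack_sqr x) (slack_sqr y) => a b qx qy.
case=> [la|[-> qa]]; case=> [lb|[-> qb]]; first by left; nra.
- by left; nra.
- by left; nra.
- by right; split; [ring|nra].
Qed.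

Lemma lex_set_vertex l q v : slack_sum v = l -> slack_sqr v = q ->
  is_vertex (lex_set l q) v.
Proof.
move=> Lv Qv; split; first by right; rewrite Lv Qv.
move=> x y t Cx Cy t0 t1 vE; suff xy : x = y.
  by move: vE; rewrite xy -scalerDl [t + _]addrC subrK scale1r.
apply: rslack_inj; move: Lv Qv; rewrite vE slack_sum_conv slack_sqr_conv.
set D := \sum_i _; move: Cx Cy; rewrite /lex_set/=.
move: (slack_sum x) (slack_sum y) (slack_sqr x) (slack_sqr y) => a b qx qy.
have t1' : 0 < 1 - t by rewrite subr_gt0.
case=> [la|[-> qa]]; case=> [lb|[-> qb]] Lv Qv; [nra|nra|nra|].
have tt : 0 < t * (1 - t) by exact: mulr_gt0.
rewrite -(pmulr_rle0 _ tt); nra.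
Qed.

Lemma slack_ge0 z i : (0 <= slack z i 0) = ((B *m z) i 0 <= d i 0).
Proof. by rewrite /slack [in LHS]mxE [(- (B *m z)) i 0]mxE subr_ge0. Qed.

(** The vertex optimizes the pair of [lex_set] over the integer points of the
    cone.  The least sum of slacks [l] exists because slacks are nonnegative
    integers, and the sum of squares is then at most [l ^ 2]. *)
Lemma IP_vertex_exists : exists v, is_vertex (IP R B d) v.
Proof.
pose feas z := forall i, 0 <= slack z i 0.
pose L k := `[< exists z, feas z /\ \sum_i slack z i 0 = k%:Z >].
have exL : exists k, L k.
  have [z Pz] := exists_int_point; exists `|(\sum_i slack z i 0)%R|%N.
  apply/asboolP; exists z; split; first by move=> i; rewrite slack_ge0.
  by rewrite gez0_abs// sumr_ge0// => i _; rewrite slack_ge0.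
have [l /asboolP exl lmin] := ex_minnP exL.
pose Q k := `[< exists z, [/\ feas z, \sum_i slack z i 0 = l%:Z &
  \sum_i slack z i 0 ^+ 2 = k%:Z] >].
have exQ : exists k, Q k.
  have [z [Pz zl]] := exl; exists `|(\sum_i slack z i 0 ^+ 2)%R|%N.
  apply/asboolP; exists z; split => //.
  by rewrite gez0_abs// sumr_ge0// => i _; exact: sqr_ge0.
have bQ k : Q k -> (k <= l * l)%N.
  move=> /asboolP[z [Pz zl zk]]; rewrite -lez_nat PoszM -zk -{2}zl mulr_sumr.
  apply: ler_sum => i _; rewrite expr2 ler_wpM2r//.
  by rewrite -zl (bigD1 i)//= lerDl sumr_ge0.
have [q /asboolP[z [Pz zl zq]] qmax] := ex_maxnP exQ bQ.
have sumE w : slack_sum (intmx R w) = (\sum_i slack w i 0)%:~R.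
  by rewrite rmorph_sum; apply: eq_bigr => i _; rewrite rslack_intmx.
have sqrE w : slack_sqr (intmx R w) = (\sum_i slack w i 0 ^+ 2)%:~R.
  by rewrite rmorph_sum; apply: eq_bigr => i _; rewrite rslack_intmx rmorphXn.
exists (intmx R z); apply: (@is_vertex_hull _ _ _ (lex_set l%:~R q%:~R)).
- exact: lex_set_convex.
- move=> x [/[swap]] /mxOver_int_intmx[w ->] /polyhedron_intmx Bw.
  have Pw : feas w by move=> i; rewrite slack_ge0.
  have sw0 : 0 <= \sum_i slack w i 0 by exact: sumr_ge0.
  have lw : l%:Z <= \sum_i slack w i 0.
    rewrite -(gez0_abs sw0) lez_nat; apply: lmin; apply/asboolP; exists w.
    by rewrite gez0_abs.
  rewrite /lex_set/= sumE sqrE ltr_int ler_int.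
  move: lw; rewrite le_eqVlt => /orP[/eqP lw|]; [right|by left].
  split; first by rewrite -lw.
  have qw0 : 0 <= \sum_i slack w i 0 ^+ 2.
    by apply: sumr_ge0 => i _; exact: sqr_ge0.
  rewrite -(gez0_abs qw0) lez_nat; apply: qmax; apply/asboolP; exists w.
  by rewrite gez0_abs.
- split; last by apply/mxOver_int_intmx; exists z.
  by apply/polyhedron_intmx => i; rewrite -slack_ge0.
- by apply: lex_set_vertex; rewrite ?sumE ?sqrE ?zl ?zq.
Qed.

(** Otherwise the steps [adj(B) e_i] and [- adj(B) e_i], which change the slack
    by multiples [\det B] of [e_i] only, both stay in the cone, and the point is
    the midpoint of two other integer points. *)
Lemma vertex_slack_lt z : is_vertex (IP R B d) (intmx R z) ->
  forall i, slack z i 0 < `|\det B|.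
Proof.
move=> vz i; rewrite ltNge; apply/negP => zi.
have [/polyhedron_intmx Pz _] := vertex_hull_mem vz.
pose u : 'cV[int]_n := \adj B *m delta_mx i 0.
have Bu : B *m u = \det B *: delta_mx i 0.
  by rewrite mulmxA mul_mx_adj mul_scalar_mx.
have mem c : `|c| = 1 -> IP R B d (intmx R (z + c *: u)).
  move=> c1 C [_]; apply; split; last by apply/mxOver_int_intmx; eexists.
  apply/polyhedron_intmx => k; rewrite mulmxDr -scalemxAr Bu.
  move: (Pz k); rewrite !mxE eqxx andbT; case: eqP => [->|] kz; last first.
    by rewrite !mulr0 addr0.
  move: zi; rewrite !mxE; set s := \sum_j _ => zi.
  have : c * \det B <= `|\det B| by rewrite (le_trans (ler_norm _))// normrM c1 mul1r.
  rewrite mulr1 => h; rewrite -lerBrDl; exact: le_trans h zi.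
have [_ ext] := vz.
have [|||uz _] := ext _ _ (2^-1) (mem 1 (normr1 _)) (mem (-1) (normrN1 _)).
- lra.
- lra.
- by rewrite /intmx; apply/colP => k; rewrite !mxE !rmorphD/= !rmorphM/= rmorphN1 rmorph1; lra.
have u0 : u = 0.
  move/colP: uz => uz; apply/colP => k; have /eqP := uz k.
  rewrite /intmx 2![map_mx _ _ _ _]mxE eqr_int mxE -subr_eq0.
  by rewrite addrAC subrr add0r scale1r => /eqP ->; rewrite mxE.
move: Bu; rewrite u0 mulmx0 => /colP/(_ i); rewrite !mxE !eqxx mulr1 => /esym/eqP.
exact/negP.
Qed.

(** With [y = x - z], the vector [B y] is the slack of [z], so that
    [\det B * (a y)] is [a adj(B)] applied to the slack: [n] terms of size at
    most [D * |\det B|]. *)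
Lemma vertex_row_le (a : 'rV[int]_n) (D : nat) z (x : 'cV[R]_n) :
  (forall i, `|(a *m \adj B) 0 i| <= D%:Z) ->
  is_vertex (IP R B d) (intmx R z) -> intmx R B *m x = intmx R d ->
  (intmx R a *m intmx R z) 0 0 <= (intmx R a *m x) 0 0 + n%:R * D%:R.
Proof.
move=> aD vz Bx.
have [/polyhedron_intmx Pz _] := vertex_hull_mem vz.
pose y := x - intmx R z.
have By : intmx R B *m y = intmx R (slack z).
  by rewrite mulmxBr Bx -intmxM /intmx -map_mxB.
have dy : (\det B)%:~R * (intmx R a *m y) 0 0 = ((a *m \adj B *m slack z) 0 0)%:~R.
  transitivity ((intmx R (a *m \adj B *m slack z)) 0 0); last by rewrite mxE.
  rewrite intmxM -By mulmxA -intmxM -mulmxA mul_adj_mx intmxM -mulmxA.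
  by rewrite /intmx map_scalar_mx mul_scalar_mx -scalemxAr [RHS]mxE.
have bnd : `|(a *m \adj B *m slack z) 0 0| <= (n * D)%:Z * `|\det B|.
  rewrite mxE (le_trans (ler_norm_sum _ _ _))//.
  rewrite (le_trans (ler_sum _ (G := fun _ => D%:Z * `|\det B|) _))//.
    move=> i _; rewrite normrM ler_pM// ger0_norm ?slack_ge0//.
    by rewrite ltW// vertex_slack_lt.
  by rewrite sumr_const card_ord -mulr_natl mulrA PoszM natz.
have : `|(intmx R a *m y) 0 0| <= (n * D)%:R.
  have d0 : 0 < `|(\det B)%:~R : R| by rewrite normr_gt0 intr_eq0.
  rewrite -(ler_pM2l d0) -normrM dy -!intr_norm mulrC -[_%:R]/((n * D)%:~R) -intrM ler_int.
  exact: bnd.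
have -> : (intmx R a *m y) 0 0 = (intmx R a *m x) 0 0 - (intmx R a *m intmx R z) 0 0.
  by rewrite mulmxBr [LHS]mxE; congr (_ + _); rewrite [LHS]mxE.
by rewrite natrM ler_norml => /andP[+ _]; lra.
Qed.

End SimplicialCone.

(** * Existence of a feasible basis *)

Section FeasibleBasis.
Variables (R : realType) (m n : nat) (A : 'M[int]_(m, n)) (b : 'cV[int]_m).
Hypothesis rankA : \rank (intmx R A) = n.

Definition tight (x : 'cV[R]_n) (i : 'I_m) :=
  (intmx R A *m x) i 0 == intmx R b i 0.

(** Slack rows are replaced by zero, not deleted, which keeps the index type
    independent of [x]; the rank is unaffected. *)
Definition tight_rows x : 'M[R]_(m, n) :=
  \matrix_(i, j) if tight x i then intmx R A i j else 0.

Lemma row_tight x i : tight x i -> row i (tight_rows x) = row i (intmx R A).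
Proof. by move=> ti; apply/rowP => j; rewrite !mxE ti. Qed.

Lemma mul_tight_rows x (y : 'cV[R]_n) i :
  (tight_rows x *m y) i 0 = if tight x i then (intmx R A *m y) i 0 else 0.
Proof.
case: ifP => ti; first by rewrite !mxE; apply: eq_bigr => j _; rewrite [in LHS]mxE ti.
by rewrite mxE big1// => j _; rewrite mxE ti mul0r.
Qed.

(** Rank deficiency gives a direction [y] that fixes all tight rows; since [A]
    has full column rank, [y] or [- y] increases some row.  Going in this
    direction up to the first row that becomes tight keeps the point in the
    polyhedron, and that row is not in the span of the old ones, which all
    vanish on [y]. *)
Lemma tight_rank_increase x : polyhedron R A b x ->
  (\rank (tight_rows x) < n)%N ->
  exists2 x', polyhedron R A b x' & (\rank (tight_rows x) < \rank (tight_rows x'))%N.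
Proof.
move=> Px rx.
have [y Ty [i0 yi0]] : exists2 y : 'cV[R]_n, tight_rows x *m y = 0 &
    exists i, 0 < (intmx R A *m y) i 0.
  have [j cj] : exists j, col j (cokermx (tight_rows x)) != 0.
    apply/existsP; rewrite -negb_forall; apply/negP => /forallP c0.
    have : \rank (cokermx (tight_rows x)) = 0%N.
      apply/eqP; rewrite mxrank_eq0; apply/eqP/matrixP => i j.
      by have /eqP/colP/(_ i) := c0 j; rewrite !mxE.
    by rewrite mxrank_coker => /eqP; rewrite subn_eq0 leqNgt rx.
  set y := col j _ in cj.
  have Ty : tight_rows x *m y = 0 by rewrite /y colE mulmxA mulmx_coker mul0mx.
  have : intmx R A *m y != 0.
    apply: contraNneq cj => Ay0; rewrite -[y]mul1mx -(mulVpmx (A := intmx R A)).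
      by rewrite -mulmxA Ay0 mulmx0.
    by rewrite /row_full rankA.
  move=> /cV0Pn[i]; rewrite neq_lt => /orP[Ayi|Ayi]; last by exists y => //; exists i.
  exists (- y); first by rewrite mulmxN Ty oppr0.
  by exists i; rewrite mulmxN mxE oppr_gt0.
(* The step length at which row [i] becomes tight. *)
pose g i := (intmx R b i 0 - (intmx R A *m x) i 0) / (intmx R A *m y) i 0.
pose K i := 0 < (intmx R A *m y) i 0.
have [i Ki imin] := Order.TotalTheory.arg_minP g (yi0 : K i0).
have g0 : 0 <= g i by apply: divr_ge0; [rewrite subr_ge0; exact: Px|exact: ltW].
pose x' := x + g i *: y.
have Ax' k : (intmx R A *m x') k 0 = (intmx R A *m x) k 0 + g i * (intmx R A *m y) k 0.
  by rewrite mulmxDr -scalemxAr [LHS]mxE; congr (_ + _); rewrite [LHS]mxE.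
have Px' : polyhedron R A b x'.
  move=> k; rewrite Ax'; have [Kk|Kk] := ltP 0 ((intmx R A *m y) k 0).
    by rewrite -lerBrDl -ler_pdivlMr//; exact: imin.
  by rewrite (le_trans _ (Px k))// gerDl mulr_ge0_le0.
have tx' k : tight x k -> tight x' k.
  move=> tk; have := mul_tight_rows x y k; rewrite Ty mxE tk /tight Ax' => <-.
  by rewrite mulr0 addr0.
have ti : tight x' i by rewrite /tight Ax' /g divfK ?lt0r_neq0// addrC subrK.
exists x' => //; have : (tight_rows x < tight_rows x')%MS.
  rewrite /ltmx; apply/andP; split.
    apply/row_subP => k; have [tk|tk] := boolP (tight x k).
      by rewrite row_tight// -(row_tight (tx' _ tk)) row_sub.
    rewrite (_ : row k _ = 0) ?sub0mx//.
    by apply/rowP => j; rewrite !mxE (negPf tk).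
  apply/negP => /row_subP/(_ i); rewrite row_tight// => /submxP[w Aw].
  have : (row i (intmx R A) *m y) 0 0 = 0 by rewrite Aw -mulmxA Ty mulmx0 mxE.
  by rewrite -row_mul mxE => Ai0; move: Ki; rewrite /K Ai0 ltxx.
by rewrite ltmxErank => /andP[].
Qed.

Lemma exists_tight_full : polyhedron R A b !=set0 ->
  exists2 x, polyhedron R A b x & \rank (tight_rows x) = n.
Proof.
move=> [x0 Px0]; pose r k := `[< exists2 x, polyhedron R A b x & \rank (tight_rows x) = k >].
have exr : exists k, r k by exists (\rank (tight_rows x0)); apply/asboolP; exists x0.
have br k : r k -> (k <= n)%N by move=> /asboolP[x _ <-]; exact: rank_leq_col.
have [k /asboolP[x Px xk] kmax] := ex_maxnP exr br; exists x => //.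
apply/eqP; rewrite eqn_leq rank_leq_col leqNgt/=; apply/negP.
move=> /(tight_rank_increase Px)[x' Px']; rewrite xk ltnNge => /negP; apply.
by apply: kmax; apply/asboolP; exists x'.
Qed.

Lemma exists_feasible_basis : polyhedron R A b !=set0 ->
  exists I : {set 'I_m}, feasible_basis R A b I.
Proof.
move=> /exists_tight_full[x Px rx].
have fullx : row_full (tight_rows x) by rewrite /row_full rx.
pose f := fullrankfun fullx; pose I := [set f i | i in 'I_n]%SET.
have f_inj : injective f by exact: fullrankfun_inj.
(* A selected row that is not tight would be a zero row of an invertible
   matrix. *)
have tf i : tight x (f i).
  apply: contraT => Nt; have /row_freeP[C TC] := fullrowsub_free fullx.
  move: (congr1 (row i) TC); rewrite row_mul (_ : row i _ = 0).
    by rewrite mul0mx => /rowP/(_ i)/eqP; rewrite !mxE eqxx eq_sym oner_eq0.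
  by apply/rowP => j; rewrite !mxE (negPf Nt).
have tI k : tight x (enum_val (A := mem I) k).
  by have /imsetP[i _ ->] := enum_valP k.
have basI : is_basis R A I.
  split; first by rewrite card_imset ?card_ord.
  apply/eqP; rewrite eqn_leq rank_leq_col/= -[X in (X <= _)%N](mxrank_fullrowsub fullx).
  apply/mxrankS/row_subP => i; rewrite row_rowsub row_tight//.
  have fI : f i \in I by exact: imset_f.
  rewrite (eq_row_sub (enum_rank_in fI (f i)))//.
  by apply/rowP => j; rewrite !mxE enum_rankK_in.
exists I; split => //; suff -> : basic_sol R A b I = x by [].
rewrite -[RHS]mul1mx -(basis_mulVmx basI) -mulmxA; congr (_ *m _).
apply/colP => k; have /eqP := tI k; rewrite !mxE => <-.
by apply: eq_bigr => j _; rewrite !mxE.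
Qed.

End FeasibleBasis.

(** * Density *)

Section BoxCounting.
Variables m t : nat.
Local Notation E := {ffun 'I_m -> 'I_(t + t).+1}.

Definition box_point (f : E) : 'cV[int]_m := \col_i ((f i : nat)%:Z - t%:Z).

Lemma box_point_inj : injective box_point.
Proof.
move=> f g /colP fg; apply/ffunP => i; apply/val_inj/eqP.
by have /eqP := fg i; rewrite !mxE (inj_eq (addIr _)).
Qed.

Lemma boxP b : box m t b <-> exists f, b = box_point f.
Proof.
split=> [bt|[f ->] i]; last by rewrite mxE; have := ltn_ord (f i); lia.
exists [ffun i => inord (absz (b i 0 + t%:Z))].
by apply/colP => i; rewrite !mxE ffunE inordK; have := bt i; lia.
Qed.

(** Counting inside the box is moved to the finite type of functions, where sets
    with undecidable membership are reached through [asbool]. *)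
Lemma card_box_setI (S : set 'cV[int]_m) :
  #|` fset_set (box m t `&` S)| = #|[set f : E | `[<S (box_point f)>]]%SET|.
Proof.
set F := [set f | _]%SET; have uF : uniq (map box_point (enum F)).
  by rewrite map_inj_uniq ?enum_uniq//; exact: box_point_inj.
rewrite cardE -(size_map box_point) -(undup_id uF) -card_fseq; congr (#|` _ |); apply/fsetP => b.
rewrite in_fset_set; last exact/finite_setIl/finite_box.
apply/idP/idP.
  move=> /set_mem[/boxP[f ->] Sf]; rewrite in_fset/= map_f// mem_enum inE; exact/asboolP.
move=> bF; apply/mem_set; move: bF; rewrite !in_fset/= => /seq.mapP[f].
rewrite mem_enum inE => /asboolP Sf ->.
by split => //; apply/boxP; exists f.
Qed.

(** Replacing the coordinate [j] of a point of the strip by any of the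
    [2t + 1] possible values, while recording its offset from [c] among [K]
    values, loses no information: the other coordinates determine [c], and the
    offset then determines the old coordinate. *)
Lemma card_strip (c : 'cV[int]_m -> int) (j : 'I_m) (K : nat) :
  (forall b b' : 'cV[int]_m, (forall i, i != j -> b i 0 = b' i 0) -> c b = c b') ->
  ((t + t).+1 *
    #|[set f : E | (c (box_point f) <= box_point f j 0 < c (box_point f) + K%:Z)%R]%SET|
   <= K * #|{: E}|)%N.
Proof.
move=> cj; set F := [set f | _]%SET.
case: K @F => [|K] F.
  rewrite (_ : F = finset.set0) ?cards0 ?muln0//.
  by apply/setP => f; rewrite !inE; lia.
pose upd (f : E) x : E := [ffun i => if i == j then x else f i].
pose h (p : 'I_(t + t).+1 * E) : 'I_K.+1 * E :=
  (inord `|(box_point p.2 j 0 - c (box_point p.2))%R|%N, upd p.2 p.1).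
pose D := finset.setX [set: 'I_(t + t).+1]%SET F.
have -> : ((t + t).+1 * #|F| = #|D|)%N by rewrite cardsX cardsT card_ord.
have -> : (K.+1 * #|{: E}| = #|{: 'I_K.+1 * E}|)%N.
  by rewrite card_prod card_ord.
have h_inj : {in D &, injective h}.
  move=> [x f] [x' f']; rewrite !inE/= => fF f'F [/(congr1 val) hc hu].
  have xE : x = x' by move/ffunP: hu => /(_ j); rewrite !ffunE eqxx.
  have ff' i : i != j -> f i = f' i.
    by move=> ij; move/ffunP: hu => /(_ i); rewrite !ffunE (negPf ij).
  have cE : c (box_point f) = c (box_point f').
    by apply: cj => i ij; rewrite !mxE ff'.
  congr (_, _) => //; apply: box_point_inj; apply/colP => i.
  have [->|ij] := eqVneq i j; last by rewrite !mxE ff'.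
  by move: hc => /=; rewrite !inordK; move: fF f'F; rewrite cE; lia.
by rewrite -(card_in_imset h_inj) max_card.
Qed.

End BoxCounting.

Lemma card_bigcup_le (I T : finType) (F : I -> {set T}) :
  (#|(\bigcup_i F i)%SET| <= \sum_i #|F i|)%N.
Proof.
elim/big_ind2: _ => [|A a B b Aa Bb|//]; first by rewrite cards0.
by rewrite (leq_trans (leq_card_setU _ _))// leq_add.
Qed.

(** The complement takes up a proportion of at most [K / (2t + 1)] of the box of
    side [2t + 1], which tends to [0]. *)
Lemma density_eq1 (R : realType) m (S : set 'cV[int]_m) (K : nat) :
  (forall t, ((t + t).+1 * #|` fset_set (box m t `&` ~` S)| <=
     K * #|` fset_set (box m t)|)%N) ->
  density R S = 1.
Proof.
move=> bad; rewrite /density.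
have card_split t : (#|` fset_set (box m t `&` S)| + #|` fset_set (box m t `&` ~` S)| =
    #|` fset_set (box m t)|)%N.
  rewrite -{3}(setIT (box m t)) !card_box_setI.
  rewrite -[RHS](cardsID [set f | `[<S (box_point f)>]]%SET); congr (_ + _)%N.
    by apply: eq_card => f; rewrite !inE; case: asboolP => // _; rewrite (asboolT (I : setT _)).
  apply: eq_card => f; rewrite !inE (asboolT (I : setT _)) andbT.
  exact: asbool_neg.
have box0 t : (0 < #|` fset_set (box m t)|)%N.
  rewrite -(setIT (box m t)) card_box_setI; apply/card_gt0P.
  by exists [ffun=> ord0]; rewrite inE; apply/asboolP.
have := @cvg_limn_inf_sup R
  (fun t => #|` fset_set (box m t `&` S)|%:R / #|` fset_set (box m t)|%:R) 1.
case=> //.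
apply: (@squeeze_cvgr _ _ _ _ (fun t => 1 - K%:R * (t.+1%:R)^-1) (fun=> 1)).
- apply: nearW => t.
  have bt0 : 0 < (#|` fset_set (box m t)|%:R : R) by rewrite ltr0n.
  apply/andP; split; last first.
    by rewrite ler_pdivrMr// mul1r ler_nat -(card_split t) leq_addr.
  rewrite ler_pdivlMr// mulrBl mul1r lerBlDr -{1}(card_split t) natrD lerD2l.
  rewrite mulrAC ler_pdivlMr// -!natrM ler_nat mulnC.
  by rewrite (leq_trans _ (bad t))// leq_mul2r; apply/orP; right; lia.
- rewrite -[X in _ --> X](subr0 1); apply: cvgB; first exact: cvg_cst.
  rewrite -(mulr0 K%:R); apply: cvgMr; exact: cvg_harmonic.
- exact: cvg_cst.
Qed.

(** For a bad [b], feasibility of [I] gives the lower bound of the strip and the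
    failure of the inequality at [j] gives the upper bound; the strip starts at
    the integer ceiling of [A_j A_I^-1 b_I], which the coordinates in [I]
    determine. *)
Lemma density_good_rhs (R : realType) m n (A : 'M[int]_(m, n)) :
  density R (good_rhs R A) = 1.
Proof.
pose C := ((n * Delta_max A) ^ 2)%N.
apply: (@density_eq1 _ _ _ (#|{: {set 'I_m} * 'I_m}| * C)%N) => t.
pose c (I : {set 'I_m}) (j : 'I_m) b := Num.ceil ((row j (intmx R A) *m basic_sol R A b I) 0 0).
pose strip (p : {set 'I_m} * 'I_m) := [set f : {ffun 'I_m -> 'I_(t + t).+1} |
  (p.2 \notin p.1) &&
  (c p.1 p.2 (box_point f) <= box_point f p.2 0 < c p.1 p.2 (box_point f) + C%:Z)]%SET.
have strip_le p : ((t + t).+1 * #|strip p| <= C * #|{: {ffun 'I_m -> 'I_(t + t).+1}}|)%N.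
  case: p => I j; rewrite /strip/=; have [jI|jI] := boolP (j \in I).
    by rewrite (eq_card (B := pred0)) ?card0 ?muln0// => f; rewrite !inE.
  apply: card_strip => b b' bb'; congr (Num.ceil ((_ *m (_ *m _)) 0 0)).
  apply/colP => k; rewrite !mxE bb'//.
  by apply: contraNneq jI => <-; exact: enum_valP.
rewrite -{2}(setIT (box m t)) !card_box_setI.
have bad_sub : [set f : {ffun 'I_m -> 'I_(t + t).+1} |
    `[<(~` good_rhs R A) (box_point f)>]]%SET \subset (\bigcup_p strip p)%SET.
  apply/fintype.subsetP => f; rewrite inE => /asboolP; set b := box_point f => /= badf.
  have [//|Nf] := boolP (f \in _); exfalso; apply: badf; right => I [basI Pb] j jI.
  rewrite leNgt; apply/negP => bj; move/negP: Nf; apply.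
  have bE : intmx R b j 0 = (b j 0)%:~R by rewrite mxE.
  apply/bigcupP; exists (I, j) => //; rewrite inE jI/= -/b; apply/andP; split.
    by rewrite /c ceil_le_int -bE -row_mul mxE; exact: Pb.
  rewrite -(ltr_int R) -bE (lt_le_trans bj)//.
  rewrite rmorphD/= lerD ?ceil_ge//.
  by rewrite /C -[_%:~R]/(_%:R) natrX natrM.
have cardT : #|[set f : {ffun 'I_m -> 'I_(t + t).+1} | `[<setT (box_point f)>]]%SET| =
    #|{: {ffun 'I_m -> 'I_(t + t).+1}}|.
  by apply: eq_card => f; rewrite !inE; apply/asboolP.
rewrite cardT (leq_trans (leq_mul (leqnn _) (subset_leq_card bad_sub)))//.
rewrite (leq_trans (leq_mul (leqnn _) (card_bigcup_le _)))// big_distrr/=.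
rewrite (leq_trans (leq_sum _ (fun p _ => strip_le p)))//.
by rewrite sum_nat_const -mulnA.
Qed.

(** * Vertices of the integer hull of a basis cone *)

(** The selection [f] has an arbitrary number [p = n] of rows, so that the lemma
    applies to [subrows A I] although [#|I| = n] is only propositional. *)
Lemma basis_cone_vertices (R : realType) m n p (A : 'M[int]_(m, n))
    (b : 'cV[int]_m) (f : 'I_p -> 'I_m) (x : 'cV[R]_n) :
  p = n -> \rank (intmx R (rowsub f A)) = n ->
  intmx R (rowsub f A) *m x = intmx R (rowsub f b) ->
  (exists v, is_vertex (IP R (rowsub f A) (rowsub f b)) v) /\
  forall v, is_vertex (IP R (rowsub f A) (rowsub f b)) v ->
    [/\ v \is a mxOver Num.int,
        forall k, (intmx R A *m v) (f k) 0 <= intmx R b (f k) 0 &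
        forall j, (intmx R A *m v) j 0 <=
          (row j (intmx R A) *m x) 0 0 + n%:R * (Delta_max A)%:R].
Proof.
move=> pn; subst p => /rank_intmx_det detB Bx; split.
  exact: IP_vertex_exists.
move=> v vv; have [Pv vint] := vertex_hull_mem vv; split => //.
  move=> k; have := Pv k; rewrite !mxE; apply: le_trans; rewrite le_eqVlt.
  by apply/orP; left; apply/eqP/eq_bigr => l _; rewrite !mxE.
move=> j; have /mxOver_int_intmx[z vE] := vint; rewrite vE in vv *.
have rowE : row j (intmx R A) = intmx R (row j A).
  by apply/rowP => l; rewrite !mxE.
have -> : (intmx R A *m intmx R z) j 0 = (intmx R (row j A) *m intmx R z) 0 0.
  by rewrite -rowE -row_mul [RHS]mxE.
rewrite rowE; apply: (vertex_row_le detB _ vv Bx) => i.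
case: n => [|n'] in A f i {x Bx detB vv Pv v vint z vE rowE} *; first by case: i.
rewrite mul_row_adj -abszE lez_nat.
rewrite (_ : \matrix_(_, _) _ = rowsub (fun k => if k == i then j else f k) A).
  exact: absz_det_rowsub.
by apply/matrixP => k l; rewrite !mxE; case: eqP.
Qed.

Theorem theorem3 (R : realType) (m n : nat) (A : 'M[int]_(m, n))
    (rankA : \rank (intmx R A) = n) :
  density R (good_rhs R A) = 1 /\
  forall b : 'cV[int]_m, good_rhs R A b -> polyhedron R A b !=set0 ->
    (exists I : {set 'I_m}, feasible_basis R A b I) /\
    forall I : {set 'I_m}, feasible_basis R A b I ->
      (exists (k : nat) (W : 'M[int]_(k, n)),
         MIP R W (subrows A I) (subrows b I) = IP R (subrows A I) (subrows b I)) /\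
      forall (k : nat) (W : 'M[int]_(k, n)),
        MIP R W (subrows A I) (subrows b I) = IP R (subrows A I) (subrows b I) ->
        (exists v : 'cV[R]_n, is_vertex (MIP R W (subrows A I) (subrows b I)) v) /\
        forall v : 'cV[R]_n, is_vertex (MIP R W (subrows A I) (subrows b I)) v ->
          polyhedron R A b v /\ v \is a mxOver Num.int.
Proof.
split; first exact: density_good_rhs.
move=> b [b0|good] bP; first by case: bP => x; rewrite b0.
split; first exact: exists_feasible_basis.
move=> I fI; split.
  exists n, 1%:M; congr convex_hull; apply/seteqP.
  by split=> x /=; rewrite /intmx map_mx1 mul1mx.
have [basI _] := fI; have [cI rI] := basI.
have BxI : intmx R (subrows A I) *m basic_sol R A b I = intmx R (subrows b I).
  by rewrite mulmxA basis_mulmxV// mul1mx.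
have [exv allv] := basis_cone_vertices cI rI BxI.
move=> k W ->; split => // v /allv[vint vI vA]; split => // j.
have [jI|jI] := boolP (j \in I).
  by have := vI (enum_rank_in jI j); rewrite enum_rankK_in.
rewrite (le_trans (vA j))// (le_trans _ (good I fI j jI))// lerD2l.
by rewrite -natrM -natrX ler_nat; case: (n * _)%N => // N; rewrite leq_pmulr.
Qed.
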